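(* Let $t\ge 2$ and let $\mathcal{O}$ be any abstract object in the class $\mathcal{C}_t$. There is no wait-free (linearizable, deterministic) implementation of $\mathcal{O}$, for $n\ge 2$ processes, that is state-quiescent HI and uses base objects each of which has fewer than $t$ states.
   Context: **Model.** An abstract object is a tuple $(Q,q_0,O,R,\Delta)$: states, initial state, operations, responses, and a deterministic sequential specification $\Delta:Q\times O\to Q\times R$; all states are reachable from $q_0$. Asynchronous processes $p_1,\dots,p_n$ communicate through finitely many shared base objects $obj_1,\dots,obj_m$ with state spaces $Q_1,\dots,Q_m$ (arbitrary atomic object types, including read-modify-write). A (deterministic) implementation gives each process a program for each operation in $O$; after an invocation the process takes steps, each consisting of local computation and one atomic primitive operation on a base object, and may eventually return a response. Each process has at most one pending operation at a time. A configuration gives the local state of each process and the state of each base object; the initial configuration is unique. An execution is an alternating sequence of configurations and steps from the initial configuration. For a finite execution $\alpha$, $\mathrm{mem}(\alpha)\in Q_1\times\dots\times Q_m$ is the vector of base-object states (not local states) in its last configuration. $H(\alpha)$ is the sequence of invocations and responses of high-level operations in $\alpha$. **Linearizability.** A completion of $H(\alpha)$ appends responses to zero or more pending operations. A linearization of $\alpha$ is a sequential history that is a permutation of a completion of $H(\alpha)$ (pending operations without responses being dropped), matches the sequential specification, and respects the real-time order of non-overlapping operations. A linearization function $h$ maps each execution $\alpha$ to a linearization $h(\alpha)$. For a sequential history $H$, $\mathrm{state}(H)$ is the state reached by applying its operations in order from $q_0$. **State-quiescent HI.** An operation is state-changing if it moves the object from some state $q$ to some $q'\ne q$. A configuration is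 state-quiescent if no state-changing operation is pending in it. An implementation is state-quiescent HI if for some linearization function $h$, for all finite executions $\alpha,\alpha'$ ending in state-quiescent configurations with $\mathrm{state}(h(\alpha))=\mathrm{state}(h(\alpha'))$ we have $\mathrm{mem}(\alpha)=\mathrm{mem}(\alpha')$. **Wait-freedom.** Every pending operation by a process returns within a finite number of steps of that process. **Class $\mathcal{C}_t$ ($t\ge2$).** $\mathcal{O}\in\mathcal{C}_t$ if $Q$ can be partitioned into $t$ nonempty subsets $X_1,\dots,X_t$ such that: (i) there is an operation $o_{read}$ that never changes the state, such that for all $q_i\in X_i$, $q_j\in X_j$ with $i\ne j$, the responses to $o_{read}$ from $q_i$ and from $q_j$ differ; (ii) for any two states $q\ne q'$ in $Q$ there is an operation $o_{change}(q,q')$ that causes the object to transition from $q$ to $q'$. *)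

(* Defs.v *)
From mathcomp Require Import all_boot.

Set Implicit Arguments.
Unset Strict Implicit.
Unset Printing Implicit Defensive.

(* The same record describes abstract objects and base objects. The state
   space need not be finite, and reachability is a separate predicate. *)
Record object := Object {
  state : Type;
  op : Type;
  resp : Type;
  init : state;
  delta : state -> op -> state * resp
}.

Arguments init : clear implicits.

Section AbstractObject.

Variable A : object.

Definition run (q : state A) (s : seq (op A)) : state A :=
  foldl (fun q o => (delta q o).1) q s.

Definition all_reachable : Prop := forall q : state A, exists s, q = run (init A) s.

Definition state_changing (o : op A) : Prop := exists q, (delta q o).1 <> q.

Definition is_partition (t : nat) (X : 'I_t -> state A -> Prop) : Prop :=
  [/\ forall i, exists q, X i q,
      forall q, exists i, X i q
    & forall i j q, X i q -> X j q -> i = j].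

Definition in_class (t : nat) : Prop :=
  exists X : 'I_t -> state A -> Prop,
  [/\ is_partition X,
      exists o_read : op A,
        (forall q, (delta q o_read).1 = q) /\
        (forall i j qi qj, i <> j -> X i qi -> X j qj ->
           (delta qi o_read).2 <> (delta qj o_read).2)
    & forall q q' : state A, q <> q' ->
        exists o_change : op A, (delta q o_change).1 = q'].

End AbstractObject.

Definition fewer_states (t : nat) (B : object) : Prop :=
  exists k (f : state B -> 'I_k), k < t /\ bijective f.

Section Histories.

Variables (A : object) (n : nat).

Inductive event :=
| Invoke of 'I_n & op A
| Respond of 'I_n & resp A.

Definition event_proc (e : event) : 'I_n :=
  match e with Invoke p _ => p | Respond p _ => p end.

Definition history := seq event.

(* A sequential history in which every operation is complete, given by its
   list of matching invocation-response pairs. *)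
Definition seq_history := seq ('I_n * op A * resp A).

Definition final_state (S : seq_history) : state A :=
  run (init A) [seq x.1.2 | x <- S].

Fixpoint legal_from (q : state A) (S : seq_history) : Prop :=
  if S is (_, o, r) :: S' then
    (delta q o).2 = r /\ legal_from (delta q o).1 S'
  else True.

Definition pending_in (H : history) (p : 'I_n) : Prop :=
  exists i o, onth H i = Some (Invoke p o) /\
    forall k r, i < k -> onth H k <> Some (Respond p r).

(* Pending invocations that receive no response are kept in [H'] here; they
   are dropped in [linearization], which only looks at the pairs of positions
   satisfying [complete_op]. *)
Definition completion (H H' : history) : Prop :=
  exists rs : seq ('I_n * resp A),
  [/\ H' = H ++ [seq Respond x.1 x.2 | x <- rs],
      uniq (unzip1 rs)
    & forall p, p \in unzip1 rs -> pending_in H p].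

(* Positions [i] and [j] of [H] hold an invocation and its matching response;
   such a pair of positions identifies a complete operation of [H]. *)
Definition complete_op (H : history) (i j : nat) : Prop :=
  exists p o r,
  [/\ i < j, onth H i = Some (Invoke p o), onth H j = Some (Respond p r)
    & forall k e, i < k < j -> onth H k = Some e -> event_proc e <> p].

Definition op_at (H : history) (ij : nat * nat) : option ('I_n * op A * resp A) :=
  match onth H ij.1, onth H ij.2 with
  | Some (Invoke p o), Some (Respond _ r) => Some (p, o, r)
  | _, _ => None
  end.

(* [pos] lists the complete operations of the completion [H'], each exactly
   once, in the order in which they appear in [S]. *)
Definition linearization (H : history) (S : seq_history) : Prop :=
  legal_from (init A) S /\
  exists H', completion H H' /\
  exists pos : seq (nat * nat),
  [/\ uniq pos,
      forall i j, (i, j) \in pos <-> complete_op H' i j,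
      map (op_at H') pos = map Some S
    & forall a b, a < size pos -> b < size pos ->
        (nth (0, 0) pos a).2 < (nth (0, 0) pos b).1 -> a < b].

End Histories.

(* What a process with a pending operation does next: return a response, or
   apply a primitive to a base object. Both determine its next local state. *)
Inductive action (m : nat) (base : 'I_m -> object) (R L : Type) :=
| Return of R & L
| Access (j : 'I_m) of op (base j) & (resp (base j) -> L).

Arguments Return {m base R L} _ _.
Arguments Access {m base R L} j _ _.

Record implementation (A : object) (n : nat) := Implementation {
  nbase : nat;
  base : 'I_nbase -> object;
  local : 'I_n -> Type;
  local_init : forall p, local p;
  program : forall p : 'I_n, op A -> local p -> action base (resp A) (local p)
}.

Arguments nbase {A n} _.
Arguments base {A n} _ _.
Arguments local {A n} _ _.
Arguments local_init {A n} _ _.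
Arguments program {A n _} p _ _.

(* [dfwith] leaves the updated index implicit, which cannot be inferred for a
   non-dependent function. *)
Definition update (J : eqType) (T : J -> Type) (f : forall j, T j) (i : J)
  (x : T i) : forall j, T j := dfwith f x.
Arguments update {J T} f i x _.

Section Executions.

Variables (A : object) (n : nat) (I : implementation A n).

(* The local state of process [p] consists of [pending p] and [loc p]; the
   component [loc p] persists between operations. *)
Record config := Config {
  pending : 'I_n -> option (op A);
  loc : forall p, local I p;
  memory : forall j, state (base I j)
}.

Definition init_config : config :=
  Config (fun=> None) (local_init I) (fun j => init (base I j)).

Inductive step :=
| Event of event A n
| Prim of 'I_n.

Definition step_proc (s : step) : 'I_n :=
  match s with Event e => event_proc e | Prim p => p end.

Inductive trans (c : config) : step -> config -> Prop :=
| TransInvoke p o :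
    pending c p = None ->
    trans c (Event (Invoke p o))
      (Config (update (pending c) p (Some o)) (loc c) (memory c))
| TransPrim p o j b k :
    pending c p = Some o ->
    program p o (loc c p) = Access j b k ->
    trans c (Prim p)
      (Config (pending c)
              (update (loc c) p (k (delta (memory c j) b).2))
              (update (memory c) j (delta (memory c j) b).1))
| TransRespond p o r l :
    pending c p = Some o ->
    program p o (loc c p) = Return r l ->
    trans c (Event (Respond p r))
      (Config (update (pending c) p None) (update (loc c) p l) (memory c)).

(* A finite execution, without its first configuration [init_config]. *)
Definition fragment := seq (step * config).

Fixpoint execution_from (c : config) (alpha : fragment) : Prop :=
  if alpha is (s, c') :: alpha' then trans c s c' /\ execution_from c' alpha'
  else True.

Definition execution (alpha : fragment) : Prop := execution_from init_config alpha.

Definition last_config (alpha : fragment) : config :=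
  last init_config (unzip2 alpha).

Definition hist (alpha : fragment) : history A n :=
  pmap (fun x => if x.1 is Event e then Some e else None) alpha.

Definition infinite_execution (cs : nat -> config) (ss : nat -> step) : Prop :=
  cs 0 = init_config /\ forall i, trans (cs i) (ss i) (cs i.+1).

(* In an infinite execution in which [p] takes infinitely many steps, each
   operation of [p] gets a response. *)
Definition wait_free : Prop :=
  forall cs ss, infinite_execution cs ss ->
  forall p i, pending (cs i) p <> None ->
  (forall N, exists2 k, N <= k & step_proc (ss k) = p) ->
  exists2 k, i <= k & exists r, ss k = Event (Respond p r).

Definition linearization_function (h : fragment -> seq_history A n) : Prop :=
  forall alpha, execution alpha -> linearization (hist alpha) (h alpha).

Definition linearizable : Prop := exists h, linearization_function h.

Definition state_quiescent (c : config) : Prop :=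
  forall p o, pending c p = Some o -> ~ state_changing o.

Definition state_quiescent_HI : Prop :=
  exists2 h, linearization_function h &
  forall alpha alpha', execution alpha -> execution alpha' ->
  state_quiescent (last_config alpha) -> state_quiescent (last_config alpha') ->
  final_state (h alpha) = final_state (h alpha') ->
  forall j, memory (last_config alpha) j = memory (last_config alpha') j.

End Executions.

(* Main.v *)
(* Two processes suffice: a reader performing [o_read] and a changer performing
   one [o_change] at a time, alone and to completion. Fix a representative
   [rep x] of each of the t classes. Between changes the configuration is
   state-quiescent, so the memory is a function of the current state. Before
   each access of the reader to an object [j], two classes x <> y give [j] the
   same contents, because [j] has fewer than t states. For every class i the
   changer can bring the object into [rep x] or [rep y] while avoiding [rep i],
   and the response to the reader does not depend on the choice. Hence one and
   the same local state of the reader is reached, for every i, by an execution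
   in which the object avoids [rep i] during the read. No response of the read
   is correct in all these executions, so the read never returns although the
   reader takes infinitely many steps. *)
Require Import Defs.
From mathcomp Require Import all_boot.
From Stdlib Require Import ClassicalEpsilon.

Set Implicit Arguments.
Unset Strict Implicit.
Unset Printing Implicit Defensive.

(** * Linearizations of histories in which each operation of one process is answered at once *)

Section SoloOperations.

Variables (A : object) (n : nat) (p : 'I_n).
Implicit Types (H : history A n) (S : seq_history A n).

Definition inv_op (e : event A n) : option (op A) :=
  if e is Invoke q o then if q == p then Some o else None else None.

Definition invs H : seq (op A) := pmap inv_op H.

Definition seq_op (x : 'I_n * op A * resp A) : option (op A) :=
  if x.1.1 == p then Some x.1.2 else None.

(** Read as a boolean, [op_of H x] tests whether the pair [x] starts at an invocation by [p]. *)
Definition op_of H (ij : nat * nat) : option (op A) := obind inv_op (onth H ij.1).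

(** Primitive steps leave no trace in a history, so an operation run alone to completion shows up as
    two adjacent events. *)
Definition answers_at_once H : Prop :=
  forall i o, onth H i = Some (Invoke p o) ->
  exists r, onth H i.+1 = Some (Respond p r).

Definition only_events H : Prop := forall i e, onth H i = Some e -> event_proc e = p.

Lemma onth_cat1 (T : Type) (s1 s2 : seq T) i x :
  onth s1 i = Some x -> onth (s1 ++ s2) i = Some x.
Proof. by move=> h; rewrite onth_cat -onthTE h. Qed.

Lemma onth_lt (T : Type) (s : seq T) i x : onth s i = Some x -> i < size s.
Proof. by move=> h; rewrite -onthTE h. Qed.

Lemma invs_cat H1 H2 : invs (H1 ++ H2) = invs H1 ++ invs H2.
Proof. exact: pmap_cat. Qed.

Lemma answers_cat H1 H2 :
  answers_at_once H1 -> answers_at_once H2 -> answers_at_once (H1 ++ H2).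
Proof.
move=> a1 a2 i o; rewrite !onth_cat; case: ltnP => [lt1 /a1 [r hr]|le1 /a2 [r hr]].
  by exists r; rewrite (onth_lt hr).
by exists r; rewrite ltnNge (leq_trans le1) //= subSn.
Qed.

Lemma answers_nil : answers_at_once [::].
Proof. by move=> i o; rewrite onth0n. Qed.

Lemma only_cat H1 H2 : only_events H1 -> only_events H2 -> only_events (H1 ++ H2).
Proof. by move=> o1 o2 i e; rewrite onth_cat; case: ltnP => _; [exact: o1|exact: o2]. Qed.

Lemma only_nil : only_events [::].
Proof. by move=> i e; rewrite onth0n. Qed.

Lemma answers_responds H (rs : seq ('I_n * resp A)) :
  answers_at_once H -> answers_at_once (H ++ [seq Respond x.1 x.2 | x <- rs]).
Proof.
move=> a; apply: answers_cat => // i o; rewrite onth_map.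
by case: (onth rs i).
Qed.

Lemma invs_responds (rs : seq ('I_n * resp A)) :
  invs [seq Respond x.1 x.2 | x <- rs] = [::].
Proof. by rewrite /invs; elim: rs. Qed.

Lemma op_ofP H i j : reflect (exists o, onth H i = Some (Invoke p o)) (op_of H (i, j)).
Proof.
rewrite /op_of /fst; case e: (onth _ _) => [[q o|q r]|] /=; first last.
- by constructor=> -[].
- by constructor=> -[].
case: eqP => [->|ne] /=; first by constructor; exists o.
by constructor=> -[o' [/ne]].
Qed.

(* An interval of [p] is a pair of adjacent positions, so it cannot overlap
   another one: the real-time order of these operations is total. *)
Lemma linearization_intervals H (pos : seq (nat * nat)) :
  answers_at_once H -> uniq pos ->
  (forall i j, (i, j) \in pos <-> complete_op H i j) ->
  (forall a b, a < size pos -> b < size pos ->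
    (nth (0, 0) pos a).2 < (nth (0, 0) pos b).1 -> a < b) ->
  [seq x <- pos | op_of H x]
  = [seq x <- [seq (i, i.+1) | i <- iota 0 (size H)] | op_of H x].
Proof.
move=> ans upos mem_pos ord_pos.
have adj x : x \in pos -> op_of H x -> x.2 = x.1.+1.
  case: x => i j /= /mem_pos [q [o [r [ltij oi oj nb]]]] /op_ofP[o' oi'].
  move: oi'; rewrite oi => -[eqp _]; rewrite {q}eqp in oi oj nb.
  have [r' or'] := ans _ _ oi.
  case: (ltngtP j i.+1) ltij => // lt _.
  by case: (nb i.+1 _ _ or'); rewrite ?ltnSn ?lt.
have noinv i : op_of H (i, i.+1) -> ~~ op_of H (i.+1, i.+2).
  move=> /op_ofP[o /ans[r hr]]; apply/op_ofP => -[o'].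
  by rewrite hr.
(* Both lists increase strictly in the first component and have the same members, so they
   coincide. *)
apply: (@irr_sorted_eq _ [rel x y : nat * nat | x.1 < y.1]).
- by move=> x y z /=; apply: ltn_trans.
- by move=> x /=; rewrite ltnn.
- rewrite sorted_pairwise; last by move=> x y z /=; apply: ltn_trans.
  have : pairwise [rel x y | (op_of H x && op_of H y) ==> (x.1 < y.1)] pos.
    apply/(pairwiseP (0, 0)) => a b /= lta ltb ltab.
    apply/implyP => /andP[].
    have /eqP := nth_uniq (0, 0) lta ltb upos.
    (* Real-time order, with [a] and [b] swapped, forbids the later entry to end before the earlier
       one begins. Equal starts contradict uniqueness, and starts one apart contradict [noinv]. *)
    move: (ord_pos b a ltb lta) (adj _ (mem_nth (0, 0) lta)) (adj _ (mem_nth (0, 0) ltb)).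
    rewrite (ltn_eqF ltab).
    case: (nth _ pos a) => k k'; case: (nth _ pos b) => l l' /= o1 o2 o3.
    move=> /eqP ne gx gy; move: ne; rewrite (o2 gx) (o3 gy) {o2} => ne.
    rewrite ltnNge leq_eqVlt; apply/negP => /orP[/eqP e|ltlk].
      by rewrite e eqxx in ne.
    move: ltlk; rewrite leq_eqVlt => /orP[/eqP e|ltlk].
      move: gx gy; rewrite -e => gx gy.
      have := noinv l; rewrite /op_of /= in gx gy *; rewrite gy => /(_ isT).
      by rewrite gx.
    by move: o1; rewrite (o3 gy) ltlk => /(_ isT); rewrite ltnNge ltnW.
  move=> /(pairwise_filter (fun x => op_of H x)).
  rewrite -(eq_in_pairwise (P := fun x => op_of H x)
    (r := [rel x y : nat * nat | x.1 < y.1])) //; last exact: filter_all.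
  by move=> x y; rewrite !unfold_in /= => -> ->.
- apply: sorted_filter; first by move=> x y z /=; apply: ltn_trans.
  by rewrite sorted_map (@eq_sorted _ _ ltn) ?iota_ltn_sorted.
move=> [i j]; rewrite !mem_filter; case: (boolP (op_of H (i, j))) => //= g.
apply/idP/mapP => [ij|[k _ [ei ej]]].
  have := adj _ ij g; rewrite /= => ->; exists i => //.
  by case/op_ofP: g => o oi; rewrite mem_iota; apply: onth_lt oi.
rewrite {i}ei {j}ej in g *; case/op_ofP: g => o oi; have [r oj] := ans _ _ oi.
apply/mem_pos; exists p, o, r; split=> // l e.
by case/andP=> /leq_ltn_trans lt /lt; rewrite ltnn.
Qed.

Lemma pmap_map (T1 T2 T3 : Type) (f : T2 -> option T3) (g : T1 -> T2) s :
  pmap f (map g s) = pmap (f \o g) s.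
Proof. by elim: s => //= x s ->. Qed.

Lemma pmap_filter_some (T1 T2 : Type) (f : T1 -> option T2) s :
  pmap f [seq x <- s | f x] = pmap f s.
Proof. by elim: s => //= x s; case e: (f x) => [y|] //=; rewrite ?e /= => ->. Qed.

Lemma pmap_onth (T1 T2 : Type) (f : T1 -> option T2) s k :
  pmap (fun i => obind f (onth s i)) (iota 0 k) = pmap f (take k s).
Proof.
elim: s k => [|x s IH] k; first by rewrite (eq_pmap (f2 := fun=> None)) => [|i]; [elim: (iota 0 k)|rewrite onth0n].
case: k => [|k] //; rewrite take_cons /=.
have -> : iota 1 k = map succn (iota 0 k) by rewrite (iotaDl 1 0).
by rewrite pmap_map (eq_pmap (f2 := fun i => obind f (onth s i))) ?IH.
Qed.

Lemma pmap_seq_op H pos S : map (op_at H) pos = map Some S ->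
  pmap seq_op S = pmap (op_of H) pos.
Proof.
elim: S pos => [|y S IH] [|[i j] pos] //= [e /IH ->].
suff -> : op_of H (i, j) = seq_op y by [].
move: e; rewrite /op_at /op_of /fst /snd.
case: (onth H i) => [[q o|q r]|] //; case: (onth H j) => [[q' o'|q' r']|] //.
by case=> <-.
Qed.

Lemma pmap_intervals H k :
  pmap (op_of H) [seq (i, i.+1) | i <- iota 0 k] = invs (take k H).
Proof. by rewrite pmap_map /invs -pmap_onth. Qed.

(** A completion only appends responses, so the invocations by [p] stay the same, and real time
    leaves only one order for their intervals. *)
Lemma linearization_invs H S : linearization H S -> answers_at_once H ->
  pmap seq_op S = invs H.
Proof.
move=> [_ [H' [[rs [-> _ _]] [pos [upos mem_pos epos ord_pos]]]]] ans.
have ans' := answers_responds (rs := rs) ans.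
rewrite (pmap_seq_op epos) -pmap_filter_some.
rewrite (linearization_intervals ans' upos mem_pos ord_pos) pmap_filter_some.
by rewrite pmap_intervals take_size invs_cat invs_responds cats0.
Qed.

(** Operations of [p] invoked before position [i] are also answered before [i], so real-time order
    places all of them in [S1]. *)
Lemma linearization_before H S i j q o r :
  linearization H S -> answers_at_once H -> i < j ->
  onth H i = Some (Invoke q o) -> onth H j = Some (Respond q r) ->
  (forall k e, i < k < j -> onth H k = Some e -> event_proc e <> q) ->
  exists S1 S2, S = S1 ++ (q, o, r) :: S2 /\
    size (invs (take i H)) <= size (pmap seq_op S1).
Proof.
move=> [_ [H' [[rs [eH' _ _]] [pos [upos mem_pos epos ord_pos]]]]] ans ltij oi oj nb.
have oi' : onth H' i = Some (Invoke q o) by rewrite eH'; apply: onth_cat1.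
have oj' : onth H' j = Some (Respond q r) by rewrite eH'; apply: onth_cat1.
have ans' : answers_at_once H' by rewrite eH'; apply: answers_responds.
have ijpos : (i, j) \in pos.
  apply/mem_pos; exists q, o, r; split=> // k e lt ok; apply: (nb k) => //.
  move: ok; rewrite eH' onth_cat; case/andP: lt => _ /ltn_trans-> //.
  exact: onth_lt oj.
set b := index (i, j) pos.
have ltb : b < size pos by rewrite index_mem.
have size_S : size S = size pos by rewrite -(size_map Some) -epos size_map.
exists (take b S), (drop b.+1 S); split.
  rewrite -{1}(cat_take_drop b S) (drop_nth (q, o, r)) ?size_S //.
  congr (_ ++ _ :: _).
  have : nth None (map (op_at H') pos) b = nth None (map Some S) b by rewrite epos.
  rewrite (nth_map (i, j)) // (nth_map (q, o, r)) ?size_S // nth_index //.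
  by rewrite /op_at /fst /snd oi' oj' => -[].
rewrite (@pmap_seq_op H' (take b pos)) ?map_take ?epos //.
have -> : take i H = take i H' by rewrite eH' take_cat (onth_lt oi).
rewrite -pmap_intervals !size_pmap -!size_filter; apply: uniq_leq_size.
  by rewrite filter_uniq // map_inj_uniq ?iota_uniq // => k l [].
move=> x; rewrite !mem_filter => /andP[gx /mapP[k]]; rewrite mem_iota /= => ltki ex.
rewrite gx /=.
have xpos : x \in pos.
  have : x \in [seq x <- pos | op_of H' x].
    rewrite (linearization_intervals ans' upos mem_pos ord_pos) mem_filter gx /=.
    rewrite ex; apply: map_f; rewrite mem_iota /=; apply: ltn_trans ltki _.
    exact: onth_lt oi'.
  by rewrite mem_filter => /andP[].
rewrite in_take //; apply: ord_pos; rewrite ?index_mem // !nth_index //.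
(* The response at [k.+1] cannot sit at position [i], which holds an invocation; hence it comes
   strictly before [i]. *)
rewrite ex /= ltn_neqAle ltki andbT; apply/eqP => eki.
move: gx; rewrite ex => /op_ofP[o' /ans'[r']].
by rewrite eki oi'.
Qed.


Definition others_read_only H : Prop := forall i q o,
  onth H i = Some (Invoke q o) -> q <> p -> forall s, (delta s o).1 = s.

Lemma linearization_read_only H S k x : linearization H S ->
  others_read_only H -> onth S k = Some x -> x.1.1 <> p ->
  forall s, (delta s x.1.2).1 = s.
Proof.
move=> [_ [H' [[rs [-> _ _]] [pos [_ _ epos _]]]]] ro Sk.
have : onth (map Some S) k = Some (Some x) by rewrite onth_map Sk.
rewrite -epos onth_map; case: (onth pos k) => // -[i j] /= [].
rewrite /op_at /fst; case oi: (onth _ i) => [[q o|//]|//].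
case: (onth _ _) => // -[//|q' r] [<-] /=.
apply: (ro i); move: oi; rewrite onth_cat; case: ltnP => _; first by [].
by rewrite onth_map; case: (onth rs _).
Qed.

Lemma run_seq_op q S :
  (forall k x, onth S k = Some x -> x.1.1 <> p -> forall s, (delta s x.1.2).1 = s) ->
  run q [seq x.1.2 | x <- S] = run q (pmap seq_op S).
Proof.
elim: S q => //= x S IH q ro.
have ro' := ro 0 x erefl; rewrite [LHS]IH => [|k y oy]; last exact: (ro k.+1).
rewrite /seq_op; case: eqP => //= ne; congr run.
exact: ro'.
Qed.

Lemma run_cat q (s1 s2 : seq (op A)) : run q (s1 ++ s2) = run (run q s1) s2.
Proof. exact: foldl_cat. Qed.

(** The operations of [p] have a forced order and the others never move the state, so the final
    state does not depend on the choice of linearization. *)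
Lemma final_state_invs H S : linearization H S -> answers_at_once H ->
  others_read_only H -> final_state S = run (init A) (invs H).
Proof.
move=> lin ans ro; rewrite -(linearization_invs lin ans) /final_state run_seq_op //.
by move=> k x; apply: linearization_read_only lin ro.
Qed.

Lemma legal_from_cat s S1 q o r S2 : legal_from s (S1 ++ (q, o, r) :: S2) ->
  (delta (run s [seq x.1.2 | x <- S1]) o).2 = r.
Proof. by elim: S1 s => [|[[q' o'] r'] S1 IH] s /= [] // _ /IH. Qed.

(** Here [c] is the number of operations of [p] linearized before the given one; legality makes [r]
    the answer in the state they produce. *)
Lemma response_invs H S i j q o r :
  linearization H S -> answers_at_once H -> others_read_only H -> i < j ->
  onth H i = Some (Invoke q o) -> onth H j = Some (Respond q r) ->
  (forall k e, i < k < j -> onth H k = Some e -> event_proc e <> q) ->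
  exists2 c, size (invs (take i H)) <= c
    & (delta (run (init A) (take c (invs H))) o).2 = r.
Proof.
move=> lin ans ro ltij oi oj nb.
have [S1 [S2 [eS le]]] := linearization_before lin ans ltij oi oj nb.
exists (size (pmap seq_op S1)) => //.
rewrite -(linearization_invs lin ans) eS pmap_cat take_size_cat //.
have [legal _] := lin; rewrite eS in legal.
rewrite -run_seq_op; first exact: legal_from_cat legal.
move=> k x ok; apply: (linearization_read_only lin ro (k := k)).
by rewrite eS; apply: onth_cat1.
Qed.

End SoloOperations.

(** * Concatenation of executions and consequences of wait-freedom *)

Section Runs.

Variables (A : object) (n : nat) (I : implementation A n).
Implicit Types (a b : fragment I).

Definition is_respond (p : 'I_n) (e : event A n) : bool :=
  if e is Respond q _ then q == p else false.

Lemma last_config_cat a b :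
  last_config (a ++ b) = last (last_config a) (unzip2 b).
Proof. by rewrite /last_config /unzip2 map_cat last_cat. Qed.

Lemma execution_from_cat c a b : execution_from c (a ++ b) <->
  execution_from c a /\ execution_from (last c (unzip2 a)) b.
Proof.
elim: a c => [|[s c'] a IH] c /=; first by tauto.
by have := IH c'; tauto.
Qed.

Lemma execution_cat a b : execution (a ++ b) <->
  execution a /\ execution_from (last_config a) b.
Proof. exact: execution_from_cat. Qed.

Lemma hist_cat a b : hist (a ++ b) = hist a ++ hist b.
Proof. exact: pmap_cat. Qed.

Lemma execution_trans a d i : execution a -> i < size a ->
  trans (last_config (take i a)) (nth d a i).1 (last_config (take i.+1 a)).
Proof.
move=> exa lti; rewrite (take_nth d lti) -cats1 last_config_cat.
move: exa; rewrite -{1}(cat_take_drop i a) (drop_nth d lti) => /execution_cat[_].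
by case: (nth d a i) => s c /= [].
Qed.

(* The fragments provided by the last hypothesis are concatenated into an
   infinite execution in which [p] takes infinitely many steps. *)
Lemma wait_free_progress p (P : fragment I -> Prop) a :
  wait_free I -> P a -> (forall b, P b -> execution b) ->
  pending (last_config a) p <> None ->
  (forall b, P b -> exists b', [/\ P (b ++ b'),
     has (fun x => step_proc x.1 == p) b' & ~~ has (is_respond p) (hist b')]) ->
  False.
Proof.
move=> wf Pa exP pend ext.
pose next (x : {b | P b}) (b' : fragment I) := [/\ P (sval x ++ b'),
  has (fun y => step_proc y.1 == p) b' & ~~ has (is_respond p) (hist b')].
(* Choice over the subtype of fragments satisfying [P] turns the extension hypothesis into a
   function that can be iterated. *)
have [f fP] : exists f, forall x, next x (f x).
  by apply: choice => -[b Pb]; apply: ext.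
pose g (x : {b | P b}) : {b | P b} :=
  exist _ (sval x ++ f x) (let: And3 h _ _ := fP x in h).
pose x k := iter k g (exist _ a Pa).
pose B k := sval (x k); pose F k := f (x k).
have BS k : B k.+1 = B k ++ F k by [].
have FP k : has (fun y => step_proc y.1 == p) (F k) by case: (fP (x k)).
have FN k : ~~ has (is_respond p) (hist (F k)) by case: (fP (x k)).
have exB k : execution (B k) by apply: exP; apply: (svalP (x k)).
have Bext k l : k <= l -> exists b, B l = B k ++ b.
  move/subnK=> <-; elim: (l - k) => [|m [b IH]]; first by exists [::]; rewrite cats0.
  by exists (b ++ F (m + k)); rewrite addSn BS IH catA.
have Bsize k : k <= size (B k).
  elim: k => // k IH; rewrite BS size_cat.
  have : 0 < size (F k) by case: (F k) (FP k).
  by move=> h; rewrite -addn1 leq_add.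
pose d : step A n * config I := (Prim A p, init_config I).
have takeB i k l : i <= size (B k) -> i <= size (B l) -> take i (B k) = take i (B l).
  wlog lekl : k l / k <= l.
    by move=> W; case: (leqP k l) => [/W|/ltnW/W] h h1 h2 => //; rewrite h.
  have [b ->] := Bext _ _ lekl => h _.
  by rewrite takel_cat.
have nthB i k l : i < size (B k) -> i < size (B l) -> nth d (B k) i = nth d (B l) i.
  move=> hk hl; rewrite -(nth_take d (ltnSn i)) (@takeB _ k l) // nth_take //.
(* [B i] has at least [i] steps, enough for a prefix of length [i]; [ss i] looks into [B i.+1]
   because position [i] must lie strictly inside. *)
pose cs i := last_config (take i (B i)).
pose ss i := (nth d (B i.+1) i).1.
have inf : infinite_execution cs ss.
  split=> [|i]; first by rewrite /cs take0.
  have -> : cs i = last_config (take i (B i.+1)).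
    by rewrite /cs (@takeB _ i i.+1) // ltnW.
  exact: execution_trans.
have csa : cs (size a) = last_config a.
  by rewrite /cs (@takeB _ (size a) 0) // take_size.
have [] := wf cs ss inf p (size a).
- by rewrite csa.
- move=> N; have /(has_nthP d)[m ltm hm] := FP N.
  exists (size (B N) + m); first by rewrite (leq_trans (Bsize N)) // leq_addr.
  rewrite /ss (@nthB _ _ N.+1) // ?BS ?size_cat ?ltn_add2l //.
  by rewrite nth_cat ltnNge leq_addr /= addKn; apply/eqP.
move=> k lek [r sk].
have noresp l : exists2 D, B l = a ++ D & ~~ has (is_respond p) (hist D).
  elim: l => [|l [D e h]]; first by exists [::] => //; rewrite cats0.
  by exists (D ++ F l); rewrite ?BS ?e ?catA // hist_cat has_cat negb_or h FN.
have [D eB /negP[]] := noresp k.+1.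
move: sk; rewrite /ss eB nth_cat ltnNge lek /= => sk.
have : k - size a < size D.
  by rewrite -(ltn_add2l (size a)) subnKC // -size_cat -eB.
elim: D (k - size a) sk {eB} => // [[s c] D] IH [|m] /= sk lt.
  by rewrite sk /= eqxx.
have := IH m sk lt; rewrite /hist /=; case: s {sk} => [e|q] //= ->.
by rewrite orbT.
Qed.


Lemma execution_rcons a s c : execution a -> trans (last_config a) s c ->
  execution (a ++ [:: (s, c)]).
Proof. by move=> exa tr; apply/execution_cat; split. Qed.

Lemma last_config_rcons a s c : last_config (a ++ [:: (s, c)]) = c.
Proof. by rewrite last_config_cat. Qed.

(** If the operation never returned, [p] running alone could always take another step, against
    wait-freedom. *)
Lemma solo_operation p o a :
  wait_free I -> execution a -> pending (last_config a) p = None ->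
  exists b r, [/\ execution (a ++ b),
    hist b = [:: Invoke p o; Respond p r],
    forall q, pending (last_config (a ++ b)) q = pending (last_config a) q
  & forall q, q <> p -> loc (last_config (a ++ b)) q = loc (last_config a) q].
Proof.
move=> wf exa idle; apply: NNPP => never.
pose c1 := Config (update (pending (last_config a)) p (Some o))
  (loc (last_config a)) (memory (last_config a)).
pose a1 := a ++ [:: (Event (Invoke p o), c1)].
have ex1 : execution a1 by apply: execution_rcons => //; apply: TransInvoke.
pose P g := exists b, [/\ g = a1 ++ b /\ execution g, hist b = [::],
  pending (last_config g) p = Some o,
  forall q, q <> p -> pending (last_config g) q = pending (last_config a) q
  & forall q, q <> p -> loc (last_config g) q = loc (last_config a) q].
have out T (f : forall q : 'I_n, T q) (v : T p) q : q <> p -> update f p v q = f q.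
  by move=> ne; rewrite /update dfwith_out // eq_sym; apply/eqP.
have upd T (f : forall q : 'I_n, T q) (v : T p) : update f p v p = v.
  by rewrite /update dfwith_in.
apply: (@wait_free_progress p P a1) => //.
- exists [::]; rewrite cats0 last_config_rcons /=; split=> //.
    by rewrite upd.
  by move=> q; apply: out.
- by move=> b [b' [[]]].
- by rewrite last_config_rcons /= upd.
move=> g [b [[eg exg] hb pg qg lg]].
case ep: (program p o (loc (last_config g) p)) => [r l|j e k].
  case: never; have tr := TransRespond pg ep.
  exists ((Event (Invoke p o), c1) :: b ++ [:: (Event (Respond p r), Config
    (update (pending (last_config g)) p None)
    (update (loc (last_config g)) p l) (memory (last_config g)))]), r.
  rewrite -cat1s !catA -/a1 -eg last_config_rcons /=; split.
  - exact: execution_rcons tr.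
  - by rewrite -/(hist _) hist_cat hb.
  - move=> q; case: (q =P p) => [->|ne]; first by rewrite upd idle.
    by rewrite out // qg.
  - by move=> q ne; rewrite out // lg.
have tr := TransPrim pg ep.
set c := Config _ _ _ in tr.
exists [:: (Prim A p, c)]; split=> //=; last by rewrite eqxx.
exists (b ++ [:: (Prim A p, c)]); rewrite last_config_rcons /=; split=> //.
- by rewrite catA -eg; split=> //; apply: execution_rcons.
- by rewrite hist_cat hb.
- by move=> q ne; rewrite out // lg.
Qed.

End Runs.

(** * The reader against the changer *)

Section Adversary.

Variables (A : object) (n t : nat) (I : implementation A n).
Variables (pr pc : 'I_n) (o_read : op A) (rep : 'I_t -> state A).

Hypothesis neq_rc : pr <> pc.
Hypothesis read_only : forall q, (delta q o_read).1 = q.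
Hypothesis change : forall q q' : state A, q <> q' -> exists o, (delta q o).1 = q'.
Hypothesis wf : wait_free I.

Implicit Types (a b : fragment I).

Definition solo (H : history A n) : Prop := only_events pc H /\ answers_at_once pc H.

Definition current a : state A := run (init A) (invs pc (hist a)).

(** These executions serve twice: as prefixes before the read starts, and as references that fix the
    memory belonging to each state. *)
Definition written q a : Prop :=
  [/\ execution a, forall p, pending (last_config a) p = None,
      loc (last_config a) pr = local_init I pr, solo (hist a) & current a = q].

(* The last clause says that since the invocation of the read the object has
   only been in states [rep x] with [x <> i]. *)
Definition reading (i : 'I_t) (l : local I pr) a : Prop :=
  [/\ execution a,
      forall p, pending (last_config a) p = if p == pr then Some o_read else None,
      loc (last_config a) pr = l
    & exists H1 H2, [/\ hist a = H1 ++ Invoke pr o_read :: H2, solo H1, solo H2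
    & forall c, size (invs pc H1) <= c ->
        exists2 x, x <> i & run (init A) (take c (invs pc (hist a))) = rep x]].

Lemma solo_nil : solo [::].
Proof. by split; [exact: only_nil|exact: answers_nil]. Qed.

Lemma solo_cat H1 H2 : solo H1 -> solo H2 -> solo (H1 ++ H2).
Proof. by move=> [o1 a1] [o2 a2]; split; [exact: only_cat|exact: answers_cat]. Qed.

Lemma solo_op (o : op A) (r : resp A) : solo [:: Invoke pc o; Respond pc r].
Proof.
split=> [[|[|i]] e|[|[|i]] o'] //=; rewrite ?onth0n //; try by case=> <-.
by case=> _; exists r.
Qed.

Lemma invs_op (o : op A) (r : resp A) : invs pc [:: Invoke pc o; Respond pc r] = [:: o].
Proof. by rewrite /invs /= eqxx. Qed.

Lemma invs_read (H1 H2 : history A n) : invs pc (H1 ++ Invoke pr o_read :: H2) = invs pc (H1 ++ H2).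
Proof. by rewrite !invs_cat /invs /=; case: eqP. Qed.

Lemma answers_read H1 H2 : solo H1 -> solo H2 ->
  answers_at_once pc (H1 ++ Invoke pr o_read :: H2).
Proof.
move=> [_ a1] [_ a2]; apply: answers_cat => // -[|i] o /=.
  by case=> /neq_rc.
exact: a2.
Qed.

Lemma others_read H1 H2 : solo H1 -> solo H2 ->
  others_read_only pc (H1 ++ Invoke pr o_read :: H2).
Proof.
move=> [o1 _] [o2 _] i q o; rewrite onth_cat; case: ltnP => _.
  by move=> /o1 /= ->.
by case: (i - size H1) => [[_ <-]|k /o2 /= ->].
Qed.

Lemma others_solo H : solo H -> others_read_only pc H.
Proof. by move=> [o1 _] i q o /o1 /= ->. Qed.

Lemma take_rcons_run (P : state A -> Prop) (s : seq (op A)) o k :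
  (forall c, k <= c -> P (run (init A) (take c s))) ->
  P (run (init A) (s ++ [:: o])) ->
  forall c, k <= c -> P (run (init A) (take c (s ++ [:: o]))).
Proof.
move=> Ps Po c lec; case: (leqP c (size s)) => [le|lt].
  by rewrite takel_cat //; apply: Ps.
by rewrite take_oversize // size_cat addn1.
Qed.

Lemma change_state q a : execution a -> pending (last_config a) pc = None ->
  current a <> q -> exists b o r, [/\ execution (a ++ b),
    hist b = [:: Invoke pc o; Respond pc r],
    forall p, pending (last_config (a ++ b)) p = pending (last_config a) p,
    loc (last_config (a ++ b)) pr = loc (last_config a) pr
  & current (a ++ b) = q].
Proof.
move=> exa idle ne; have [o eo] := change ne.
have [b [r [exb hb pb lb]]] := solo_operation o wf exa idle.
exists b, o, r; split=> //; first exact: lb.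
by rewrite /current hist_cat hb invs_cat invs_op run_cat.
Qed.

Lemma written_exists q : exists a, written q a.
Proof.
have w0 : written (init A) [::] by split=> //; exact: solo_nil.
case: (classic (init A = q)) => [<-|ne]; first by exists [::].
have [ex0 p0 l0 s0 c0] := w0.
have [|b [o [r [exb hb pb lb cb]]]] := change_state ex0 (p0 pc) (q := q).
  by rewrite c0.
exists ([::] ++ b); split=> //.
by rewrite hist_cat hb; exact: solo_op.
Qed.

Lemma reading_start i : 1 < t -> exists a, reading i (local_init I pr) a.
Proof.
move=> lt1t.
(* The state at the invocation counts as a state during the read, so the class written beforehand
   must already differ from [i]. *)
have [x neqx] : exists x : 'I_t, x <> i.
  have lt0t := ltnW lt1t.
  case: (i =P Ordinal lt0t) => [->|ne]; last by exists (Ordinal lt0t) => e; case: ne.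
  by exists (Ordinal lt1t).
have [a [exa pa la sa ca]] := written_exists (rep x).
have tr := TransInvoke o_read (pa pr).
eexists; split; first exact: (execution_rcons exa tr).
- move=> p; rewrite last_config_rcons /= /update.
  case: eqP => [->|ne]; first by rewrite dfwith_in.
  by rewrite dfwith_out ?pa // eq_sym; apply/eqP.
- by rewrite last_config_rcons.
exists (hist a), [::]; rewrite hist_cat; split=> //; first exact: solo_nil.
move=> c le; exists x => //.
by rewrite invs_read cats0 take_oversize.
Qed.

Lemma reading_change i l a x : x <> i -> reading i l a ->
  exists b, [/\ reading i l (a ++ b), current (a ++ b) = rep x
    & ~~ has (is_respond pr) (hist b)].
Proof.
move=> nexi rd; case: (classic (current a = rep x)) => [e|ne].
  by exists [::]; rewrite cats0.
have [exa pa la [H1 [H2 [ha s1 s2 avoid]]]] := rd.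
have idle : pending (last_config a) pc = None.
  by rewrite pa; case: eqP => // e; case: neq_rc.
have [b [o [r [exb hb pb lb cb]]]] := change_state exa idle ne.
exists b; split=> //; last by rewrite hb /= orbF; apply/eqP => e; case: neq_rc.
split=> //; first by move=> p; rewrite pb.
  by rewrite lb.
exists H1, (H2 ++ hist b); split=> //.
- by rewrite hist_cat ha -catA.
- by rewrite hb; apply: solo_cat => //; exact: solo_op.
rewrite hist_cat hb invs_cat invs_op.
apply: (take_rcons_run (P := fun q => exists2 x, x <> i & q = rep x)) => //.
by exists x => //; rewrite -cb /current hist_cat hb invs_cat invs_op.
Qed.

(** A primitive step adds no event, so the clause on avoided states carries over; the new local
    state depends only on [l] and the contents of [j]. *)
Lemma reading_access i l a j e k : reading i l a ->
  program pr o_read l = Access j e k ->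
  exists c, reading i (k (delta (memory (last_config a) j) e).2)
    (a ++ [:: (Prim A pr, c)]).
Proof.
move=> [exa pa la [H1 [H2 [ha s1 s2 avoid]]]] ep.
have pp : pending (last_config a) pr = Some o_read by rewrite pa eqxx.
rewrite -la in ep; have tr := TransPrim pp ep.
eexists; split; first exact: (execution_rcons exa tr).
- by move=> p; rewrite last_config_rcons /= pa.
- by rewrite last_config_rcons /= /update dfwith_in.
by exists H1, H2; rewrite hist_cat cats0.
Qed.

(** The read is linearized after all changes preceding its invocation, so its response belongs to a
    state that the object has had since then. *)
Lemma reading_return i l a r l' : linearizable I -> reading i l a ->
  program pr o_read l = Return r l' ->
  exists2 x, x <> i & (delta (rep x) o_read).2 = r.
Proof.
move=> [h lin] [exa pa la [H1 [H2 [ha s1 s2 avoid]]]] ep.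
have pp : pending (last_config a) pr = Some o_read by rewrite pa eqxx.
rewrite -la in ep; have tr := TransRespond pp ep.
have := lin _ (execution_rcons exa tr).
set a' := a ++ _; set H := hist a'.
have eH : H = hist a ++ [:: Respond pr r] by rewrite /H hist_cat.
have inv : invs pc H = invs pc (hist a) by rewrite eH invs_cat cats0.
move/response_invs => /(_ pc (size H1) (size (hist a)) pr o_read r) [].
- rewrite eH ha; apply: answers_cat; first exact: answers_read.
  by case=> [|i'] o //=; rewrite onth0n.
- rewrite eH ha => m q o; rewrite onth_cat; case: ltnP => _.
    exact: others_read.
  by case: (m - _) => [|m'] //=; rewrite onth0n.
- by rewrite ha size_cat /= addnS ltnS leq_addr.
- by rewrite eH ha -catA onth_cat ltnn subnn.
- by rewrite eH onth_cat ltnn subnn.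
- move=> m e /andP[lt1 lt2]; rewrite eH onth_cat lt2 ha onth_cat ltnNge ltnW //=.
  rewrite -(subnSK lt1) /= => oe; case: s2 => o2 _.
  by rewrite (o2 _ _ oe) => e'; case: neq_rc.
move=> c; rewrite eH {1}ha -catA take_size_cat // => /avoid[x nex ex].
by rewrite -eH inv ex; exists x.
Qed.

(** A pending read does not spoil state-quiescence, so HI compares every reading execution in state
    [rep x] with one fixed execution that merely writes [rep x]. *)
Lemma canonical_memory : state_quiescent_HI I ->
  exists mem : 'I_t -> forall j, state (base I j),
  forall i l a x, reading i l a -> current a = rep x ->
  forall j, memory (last_config a) j = mem x j.
Proof.
move=> [h lin HI].
have [C wC] := choice _ (fun x => written_exists (rep x)).
exists (fun x => memory (last_config (C x))) => i l a x.
move=> [exa pa la [H1 [H2 [ha s1 s2 _]]]] ca.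
have [exC pC lC sC cC] := wC x.
apply: HI => //.
- move=> p o; rewrite pa; case: eqP => // _ [<-] [q []].
  exact: read_only.
- by move=> p o; rewrite pC.
rewrite (final_state_invs (p := pc) (lin _ exC)) //; first last.
- exact: others_solo.
- by case: sC.
rewrite (final_state_invs (p := pc) (lin _ exa)); first by rewrite -!/(current _) ca cC.
- by rewrite ha; exact: answers_read.
- by rewrite ha; exact: others_read.
Qed.

(** Pigeonhole principle. *)
Lemma fewer_states_collision (B : object) (f : 'I_t -> state B) :
  fewer_states t B -> exists x y, x <> y /\ f x = f y.
Proof.
move=> [k [g [ltkt /bij_inj inj_g]]].
have /injectivePn[x [y /eqP nexy exy]] : ~~ injectiveb (g \o f).
  apply/negP => /injectiveP/leq_card; rewrite !card_ord leqNgt.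
  by rewrite ltkt.
by exists x, y; split=> //; apply: inj_g.
Qed.

(* If [rep x] and [rep y] put object [j] in the same state, one of [x] and [y]
   differs from [i], so [l'] can be chosen independently of [i]. *)
Lemma reading_step l j e k : state_quiescent_HI I -> fewer_states t (base I j) ->
  program pr o_read l = Access j e k ->
  exists l', forall i a, reading i l a -> exists b, [/\ reading i l' (a ++ b),
    has (fun x => step_proc x.1 == pr) b & ~~ has (is_respond pr) (hist b)].
Proof.
move=> /canonical_memory[mem memE] /fewer_states_collision few ep.
have [x [y [nexy exy]]] := few (fun z => mem z j).
exists (k (delta (mem x j) e).2) => i a rd.
have [z nez ez] : exists2 z, z <> i & mem z j = mem x j.
  by case: (x =P i) => [<-|nex]; [exists y => // /esym|exists x].
have [b [rdb cb nb]] := reading_change nez rd.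
have [c rdc] := reading_access rdb ep.
rewrite (memE _ _ _ _ rdb cb) ez -catA in rdc.
exists (b ++ [:: (Prim A pr, c)]); split=> //.
  by rewrite has_cat /= eqxx orbT.
by rewrite hist_cat cats0.
Qed.

Lemma no_wait_free_reading : 1 < t -> linearizable I -> state_quiescent_HI I ->
  (forall j, fewer_states t (base I j)) ->
  exists x y, x <> y /\ (delta (rep x) o_read).2 = (delta (rep y) o_read).2.
Proof.
move=> lt1t lin HI few; apply: NNPP => distinct.
pose all_reading l := forall i, exists a, reading i l a.
have step l : all_reading l -> exists l', forall i a, reading i l a ->
    exists b, [/\ reading i l' (a ++ b),
      has (fun x => step_proc x.1 == pr) b & ~~ has (is_respond pr) (hist b)].
  move=> al; case ep: (program pr o_read l) => [r l'|j e k].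
    have ret i : exists2 x, x <> i & (delta (rep x) o_read).2 = r.
      by have [a rd] := al i; apply: reading_return lin rd ep.
    (* One class answering [r] is found first, then a second one by taking [i] to be the first. *)
    have [x _ ex] := ret (Ordinal lt1t); have [y ney ey] := ret x.
    by case: distinct; exists y, x; rewrite ex ey.
  exact: reading_step HI (few j) ep.
pose i0 := Ordinal lt1t.
(* The infinite execution is built for the single class [i0]; [all_reading] carries along executions
   for every class, which rule out a return. *)
pose P a := exists2 l, all_reading l & reading i0 l a.
have al0 : all_reading (local_init I pr) by move=> i; apply: reading_start.
have [a0 rd0] := al0 i0.
apply: (@wait_free_progress _ _ _ pr P a0) => //.
- by exists (local_init I pr).
- by move=> b [l _ []].
- by case: rd0 => _ -> _ _; rewrite eqxx.
move=> a [l al rd]; have [l' nxt] := step l al.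
have [b [rdb hb nb]] := nxt _ _ rd.
exists b; split=> //; exists l' => // i.
have [a' rd'] := al i; have [b' [rdb' _ _]] := nxt _ _ rd'.
by exists (a' ++ b').
Qed.

End Adversary.

Theorem theorem17 (t n : nat) (A : object)
    (ht : 2 <= t) (hn : 2 <= n)
    (hreach : all_reachable A) (hclass : in_class A t) :
  ~ exists I : implementation A n,
      [/\ wait_free I, linearizable I, state_quiescent_HI I
        & forall j, fewer_states t (base I j)].
Proof.
move=> [I [wf lin HI few]].
have [X [[ne_X _ _] [o_read [ro sep]] change]] := hclass.
have [rep repX] := choice _ ne_X.
(* Process 0 is the reader and process 1 the changer. *)
have ne : Ordinal (ltnW hn) <> Ordinal hn by [].
have [x [y [nexy]]] := no_wait_free_reading rep ne ro change wf ht lin HI few.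
exact: sep nexy (repX x) (repX y).
Qed.
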